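(* Let $n$ be an even positive integer and let $Q\subseteq\mathbb{R}^{n-1}$ be the convex hull of all dual degree partitions $(d^*_1,\ldots,d^*_{n-1})$ of simple graphs on $n$ vertices. Then the facet-defining inequalities of $Q$ are \[ n \geq x_1 \geq x_2 \geq \cdots \geq x_{n-1} \geq 0, \] and the extreme points of $Q$ are the $n$ points \[ \mathbf{a}^{(k)} = (\underbrace{n,\ldots,n}_{k},\underbrace{0,\ldots,0}_{n-1-k}), \quad k=0,\ldots,n-1. \]
   Context: All graphs are simple (undirected, no loops, no multiple edges) on the vertex set $\{1,\ldots,n\}$. The degree $d_i$ of vertex $i$ is its number of neighbors; vertices are labeled so that $n-1\ge d_1\ge\cdots\ge d_n\ge 0$, and $\mathbf{d}=(d_1,\ldots,d_n)$ is the degree partition. The dual degree partition of the graph is $\mathbf{d}^*=(d^*_1,\ldots,d^*_n)$ where $d^*_j=|\{i : d_i\ge j\}|$, so $n\ge d^*_1\ge\cdots\ge d^*_n=0$. Since $d^*_n=0$ always, each dual degree partition is regarded as the point $(d^*_1,\ldots,d^*_{n-1})\in\mathbb{R}^{n-1}$ (the last coordinate is suppressed). *)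

(* Defs.v *)
From mathcomp Require Import all_boot all_order all_algebra.
From mathcomp Require Import boolp classical_sets reals convex.

Set Implicit Arguments.
Unset Strict Implicit.
Unset Printing Implicit Defensive.

Import Order.TTheory GRing.Theory Num.Theory.

Local Open Scope classical_set_scope.
Local Open Scope ring_scope.

Definition simple_graph (n : nat) (e : rel 'I_n) : Prop :=
  symmetric e /\ irreflexive e.

Definition degree (n : nat) (e : rel 'I_n) (i : 'I_n) : nat :=
  #|[set k : 'I_n | e i k]%SET|.

(* This count does not depend on how the vertices are labeled, so the labeling
   need not be assumed to sort the degrees. *)
Definition dual_degree (n : nat) (e : rel 'I_n) (j : nat) : nat :=
  #|[set i : 'I_n | (j <= degree e i)%N]%SET|.

(* Coordinate j : 'I_n.-1 of a row vector stands for x_(j+1). *)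
Definition dual_degree_point (R : realType) (n : nat) (e : rel 'I_n) :
    'rV[R]_n.-1 :=
  \row_(j < n.-1) (dual_degree e j.+1)%:R.

Definition convex_hull (R : realType) (d : nat) (S : set 'rV[R]_d) :
    set 'rV[R]_d :=
  smallest (@convex_set R 'rV[R]_d) S.

Definition dual_degree_polytope (R : realType) (n : nat) : set 'rV[R]_n.-1 :=
  convex_hull [set dual_degree_point R e | e in @simple_graph n].
Arguments dual_degree_polytope R n : clear implicits.

Definition dot (R : realType) (d : nat) (a x : 'rV[R]_d) : R :=
  \sum_(j < d) a 0 j * x 0 j.

Definition affinely_independent (R : realType) (d m : nat)
    (p : 'I_m -> 'rV[R]_d) : Prop :=
  forall c : 'I_m -> R,
    \sum_i c i = 0 -> \sum_i c i *: p i = 0 -> forall i, c i = 0.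

(* [affine_rank S r] says that r is the largest number of affinely independent
   points of S, i.e. that S has dimension r - 1 (the empty set has r = 0). *)
Definition affine_rank (R : realType) (d : nat) (S : set 'rV[R]_d) (r : nat) :
    Prop :=
  (exists2 p : 'I_r -> 'rV[R]_d, forall i, S (p i) & affinely_independent p) /\
  (forall (m : nat) (p : 'I_m -> 'rV[R]_d),
     (forall i, S (p i)) -> affinely_independent p -> (m <= r)%N).

(* The inequality a.x <= b is valid on Q, and the face of Q where it is tight
   has dimension dim Q - 1. *)
Definition facet_defining (R : realType) (d : nat) (Q : set 'rV[R]_d)
    (a : 'rV[R]_d) (b : R) : Prop :=
  (forall x, Q x -> dot a x <= b) /\
  exists2 r : nat, affine_rank Q r.+1
                 & affine_rank (Q `&` [set x | dot a x = b]) r.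

Definition extreme_points (R : realType) (d : nat) (Q : set 'rV[R]_d) :
    set 'rV[R]_d :=
  [set x | Q x /\
     forall (y z : 'rV[R]_d) (t : R), Q y -> Q z -> 0 < t -> t < 1 ->
       x = t *: y + (1 - t) *: z -> y = x /\ z = x].

(* [dot (chain_coef R i) x <= chain_rhs R i] is the i-th inequality
   x_(i+1) - x_i <= 0 of the chain n >= x_1 >= ... >= x_(n-1) >= 0, under the
   convention x_0 = n, x_n = 0: it reads x_1 <= n for i = 0 and
   - x_(n-1) <= 0 for i = n-1. *)
Definition chain_coef (R : realType) (n : nat) (i : 'I_n) : 'rV[R]_n.-1 :=
  \row_(j < n.-1) ((j == i :> nat)%:R - (j.+1 == i :> nat)%:R).
Arguments chain_coef R {n} i.

Definition chain_rhs (R : realType) (n : nat) (i : 'I_n) : R :=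
  if i == 0%N :> nat then n%:R else 0.
Arguments chain_rhs R {n} i.

Definition step_point (R : realType) (n : nat) (k : 'I_n) : 'rV[R]_n.-1 :=
  \row_(j < n.-1) (if (j < k)%N then n%:R else 0).
Arguments step_point R {n} k.

(* Main.v *)
(* Put x_0 = n and x_n = 0.  The n slacks x_i - x_(i+1) sum to n and, divided
   by n, are the barycentric coordinates of x with respect to the n affinely
   independent points a^(k): the chain of inequalities cuts out the simplex with
   these vertices, whose facets and extreme points can be read off the
   coordinates.  Dual degree partitions satisfy the chain, and for n even each
   a^(k) is the dual degree partition of a k-regular circulant graph. *)
Require Import Defs.
From mathcomp Require Import all_boot all_order all_algebra.
From mathcomp Require Import boolp classical_sets reals convex.
From mathcomp Require Import zify interval_inference.

Import Order.TTheory GRing.Theory Num.Theory.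

Local Open Scope classical_set_scope.
Local Open Scope ring_scope.

(** * Regular circulant graphs *)

Lemma card_ord_interval {n a k : nat} :
  (a + k <= n)%N -> #|[set x : 'I_n | (a <= x < a + k)%N]%SET| = k.
Proof.
move=> le_akn.
have lt_shift (i : 'I_k) : (a + i < n)%N by have := ltn_ord i; lia.
pose f i := Ordinal (lt_shift i).
have f_inj : injective f by move=> i j /(congr1 val) /= /addnI/val_inj.
rewrite -[RHS]card_ord -(card_imset xpredT f_inj); apply: eq_card => x.
rewrite inE; apply/idP/imsetP => [/andP[ax xak]|[i _ ->]] /=.
  have lt_xa : (x - a < k)%N by lia.
  by exists (Ordinal lt_xa) => //; apply: val_inj; rewrite /= subnKC.
by have := ltn_ord i; lia.
Qed.

(** [S] serves as the connection set of a circulant graph: closure under negation makes adjacency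
    symmetric, and leaving out 0 excludes loops. Odd sizes are reachable because n = d + 1 is even,
    so that n/2 is a nonzero residue equal to its own negative. *)
Lemma symmetric_connection_set {d k : nat} : odd d -> (k <= d)%N ->
  exists S : {set 'I_d.+1},
    [/\ 0 \notin S, forall x, (- x \in S) = (x \in S) & #|S| = k].
Proof.
move=> d_odd.
(* An odd k gives a block of residues centred at n/2; for an even k, take the
   nonzero residues outside the block of the odd size n - 1 - k. *)
wlog k_odd : k / odd k => [IHk le_kd|le_kd].
  have [k_odd|k_even] := boolP (odd k); first exact: IHk.
  have [||S [S0 SN cardS]] := IHk (d - k)%N; [lia|lia|].
  exists (~: (0 |: S))%SET; split=> [|x|].
  - by rewrite !inE eqxx.
  - by rewrite !inE oppr_eq0 SN.
  - by have := cardsC (0 |: S)%SET; rewrite cardsU1 S0 cardS card_ord; move: #|_|; lia.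
(* For [k] odd, [k./2] is (k - 1)/2, so x -> n - x maps the block onto itself; [k <= d] makes it
   start at 1 or later. *)
exists [set x : 'I_d.+1 | (d.+1./2 - k./2 <= x < d.+1./2 - k./2 + k)%N]%SET.
split=> [|x|]; first by rewrite inE /=; lia.
  rewrite !inE /=.
  (* The value of [- x] is n - x reduced modulo n; the reduction matters only at 0. *)
  case: x => [[|x] /= lt_xd]; first by rewrite subn0 modnn.
  by rewrite modn_small; lia.
by apply: card_ord_interval; lia.
Qed.

Lemma exists_regular_graph {d k : nat} : odd d -> (k <= d)%N ->
  exists2 e : rel 'I_d.+1, simple_graph e & forall i, degree e i = k.
Proof.
move=> d_odd le_kd.
have [S [S0 SN cardS]] := symmetric_connection_set d_odd le_kd.
exists (fun i j => j - i \in S); first split=> [i j|i].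
- by rewrite -SN opprB.
- by rewrite subrr (negbTE S0).
(* Translation by [- i] carries the neighbourhood of [i] bijectively onto [S]. *)
move=> i; rewrite /degree -cardS -(card_preimset S (addIr (- i))).
by apply: eq_card => j; rewrite !inE.
Qed.

(** * Finite convex combinations *)

(** Convexity speaks of two points only. By induction, the first point is split off and the other
    weights are divided by their sum 1 - w0; if w0 = 1 they all vanish. *)
Lemma convex_set_sum {R : realType} {d m : nat} {A : set 'rV[R]_d}
    {w : 'I_m -> R} {p : 'I_m -> 'rV[R]_d} :
  @convex_set R 'rV[R]_d A -> (forall i, 0 <= w i) -> \sum_i w i = 1 ->
  (forall i, A (p i)) -> A (\sum_i w i *: p i).
Proof.
move=> cvxA.
elim: m w p => [|m IHm] w p w_ge0.
  by rewrite big_ord0 => /eqP; rewrite eq_sym oner_eq0.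
rewrite !big_ord_recl => sum_w Ap.
set w0 := w ord0 in sum_w *.
have rest_ge0 : 0 <= \sum_(i < m) w (lift ord0 i) by apply: sumr_ge0.
have sum_rest : \sum_(i < m) w (lift ord0 i) = 1 - w0.
  by rewrite -sum_w addrC addKr.
have w0_le1 : w0 <= 1 by rewrite -subr_ge0 -sum_rest.
have [w0_1|w0_neq1] := eqVneq w0 1.
  rewrite big1 => [|i _]; first by rewrite w0_1 scale1r addr0.
  rewrite w0_1 subrr in sum_rest.
  by rewrite (psumr_eq0P _ sum_rest) ?scale0r// => j _.
have w0'_gt0 : 0 < 1 - w0 by rewrite subr_gt0 lt_neqAle w0_neq1.
have Arest : A (\sum_(i < m) (w (lift ord0 i) / (1 - w0)) *: p (lift ord0 i)).
  apply: IHm => [i||i]; last exact: Ap.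
    by rewrite divr_ge0// ltW.
  by rewrite -mulr_suml sum_rest divff// gt_eqF.
rewrite (_ : \sum_(i < m) _ = (1 - w0) *:
    \sum_(i < m) (w (lift ord0 i) / (1 - w0)) *: p (lift ord0 i)); last first.
  rewrite scaler_sumr; apply: eq_bigr => i _.
  by rewrite scalerA mulrC divfK// gt_eqF.
exact/set_mem/(cvxA _ _ (Itv01 (w_ge0 ord0) w0_le1) (mem_set (Ap ord0))
                    (mem_set Arest)).
Qed.

(** * Slacks as barycentric coordinates *)

Section Slack.
Context {R : realType} {d : nat}.
Implicit Types (x y z : 'rV[R]_d) (i k : 'I_d.+1).

Lemma dotD (a x y : 'rV[R]_d) : dot a (x + y) = dot a x + dot a y.
Proof. by rewrite -big_split; apply: eq_bigr => j _; rewrite mxE mulrDr. Qed.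

Lemma dotZ (a x : 'rV[R]_d) (t : R) : dot a (t *: x) = t * dot a x.
Proof. by rewrite mulr_sumr; apply: eq_bigr => j _; rewrite mxE mulrCA. Qed.

Lemma dot0 (a : 'rV[R]_d) : dot a 0 = 0.
Proof. by rewrite /dot big1// => j _; rewrite mxE mulr0. Qed.

Lemma dot_sum (a : 'rV[R]_d) (I : finType) (F : I -> 'rV[R]_d) :
  dot a (\sum_i F i) = \sum_i dot a (F i).
Proof. exact: (big_morph (dot a) (dotD a) (dot0 a)). Qed.

Lemma dot_delta (a : 'rV[R]_d) (j : 'I_d) : dot a (delta_mx 0 j) = a 0 j.
Proof.
rewrite /dot (bigD1 j)//= big1 => [|l lj].
  by rewrite mxE !eqxx mulr1 addr0.
by rewrite mxE (negbTE lj) andbF mulr0.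
Qed.

(* The coordinates [x_0 = n, x_1, ..., x_(n-1), x_n = 0] with [n = d + 1]. *)
Definition padded x (m : nat) : R :=
  nth 0 (d.+1%:R :: [seq x 0 j | j : 'I_d]) m.

Definition slack i x : R := chain_rhs R i - dot (chain_coef R i) x.

Lemma size_coords x : size [seq x 0 l | l : 'I_d] = d.
Proof. by rewrite size_map size_enum_ord. Qed.

Lemma nth_coord x (j : 'I_d) : nth 0 [seq x 0 l | l : 'I_d] j = x 0 j.
Proof. by rewrite (nth_map j) ?size_enum_ord// nth_ord_enum. Qed.

Lemma padded_ord x (j : 'I_d) : padded x j.+1 = x 0 j.
Proof. exact: nth_coord. Qed.

Lemma padded_last x : padded x d.+1 = 0.
Proof. by rewrite /padded nth_default//= size_coords. Qed.

(** For [m >= d] no index matches and [nth] returns its default 0, in agreement with the convention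
    x_n = 0. *)
Lemma sum_indicator_coord x (m : nat) :
  \sum_(j < d) (j == m :> nat)%:R * x 0 j = nth 0 [seq x 0 l | l : 'I_d] m.
Proof.
have [lt_md|le_dm] := ltnP m d; last first.
  rewrite nth_default ?size_coords//; apply: big1 => j _.
  by rewrite ltn_eqF ?mul0r// (leq_trans (ltn_ord j)).
rewrite (nth_coord x (Ordinal lt_md)) (bigD1 (Ordinal lt_md))//= eqxx mul1r.
by rewrite big1 ?addr0// => j; rewrite -val_eqE => /negbTE /= ->; rewrite mul0r.
Qed.

Lemma slackE i x : slack i x = padded x i - padded x i.+1.
Proof.
rewrite /slack /dot.
under eq_bigr do rewrite mxE mulrBl.
rewrite sumrB sum_indicator_coord /chain_rhs /padded.
case: i => [[|m] lt_m] /=.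
  by rewrite big1 ?subr0// => j _; rewrite mul0r.
under [X in _ - (_ - X)]eq_bigr do rewrite eqSS.
by rewrite sum_indicator_coord sub0r opprB.
Qed.

(** The sum telescopes to x_m - x_n. With m = 0 it normalises the weights; with m = j + 1 it
    recovers a coordinate from them. *)
Lemma sum_slack_geq x (m : nat) : (m <= d.+1)%N ->
  \sum_(i < d.+1 | (m <= i)%N) slack i x = padded x m.
Proof.
move=> le_m; under eq_bigr do rewrite slackE.
rewrite -(big_geq_mkord _ _ xpredT (fun l : nat => padded x l - padded x l.+1)).
under eq_bigr do rewrite -opprB.
by rewrite sumrN telescope_sumr// padded_last sub0r opprK.
Qed.

Lemma sum_slack x : \sum_i slack i x = d.+1%:R.
Proof. by rewrite -[RHS](sum_slack_geq x 0 isT). Qed.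

Definition weight i x : R := slack i x / d.+1%:R.

Lemma sum_weight x : \sum_i weight i x = 1.
Proof. by rewrite -mulr_suml sum_slack divff// pnatr_eq0. Qed.

Lemma sum_weight_step x : \sum_i weight i x *: step_point R i = x.
Proof.
apply/rowP => j; rewrite summxE -padded_ord -sum_slack_geq; last first.
  by rewrite ltnS ltnW.
rewrite [RHS]big_mkcond; apply: eq_bigr => i _; rewrite !mxE.
by case: ifP => _; rewrite ?mulr0// divfK// pnatr_eq0.
Qed.

(** Once padded, a^(k) has a single drop, from n to 0 between positions k and k + 1. *)
Lemma slack_step i k : slack i (step_point R k) = d.+1%:R * (i == k)%:R.
Proof.
have paddedE (m : nat) :
    padded (step_point R k) m = if (m <= k)%N then d.+1%:R else 0.
  case: m => [//|m]; have [lt_md|le_dm] := ltnP m d.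
    by rewrite (padded_ord _ (Ordinal lt_md)) mxE.
  rewrite /padded nth_default ?ifF//=; last by rewrite size_coords.
  by have := ltn_ord k; lia.
rewrite slackE !paddedE -val_eqE /=.
by case: ltngtP => _; rewrite ?mulr0 ?mulr1 ?subr0 ?subrr.
Qed.

Lemma slack_conv i (t : R) y z :
  slack i (t *: y + (1 - t) *: z) = t * slack i y + (1 - t) * slack i z.
Proof.
rewrite /slack dotD !dotZ !mulrBr addrACA -opprD; congr (_ - _).
by rewrite -mulrDl subrKC mul1r.
Qed.

Lemma slack_inj x y : (forall i, slack i x = slack i y) -> x = y.
Proof.
move=> eq_xy; rewrite -(sum_weight_step x) -(sum_weight_step y).
by apply: eq_bigr => i _; rewrite /weight eq_xy.
Qed.

Lemma chain_sortedP x :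
  sorted >=%R (d.+1%:R :: rcons [seq x 0 j | j : 'I_d] 0) <->
  forall i, 0 <= slack i x.
Proof.
rewrite -rcons_cons; split=> [/(sortedP 0) xs i|x_ge0].
  have := xs i; rewrite !nth_rcons_default size_rcons /= size_coords ltnS.
  by rewrite ltn_ord slackE subr_ge0; apply.
apply/(sortedP 0) => i.
rewrite !nth_rcons_default size_rcons /= size_coords ltnS => lt_i.
by have := x_ge0 (Ordinal lt_i); rewrite slackE subr_ge0.
Qed.

Definition chain_simplex : set 'rV[R]_d := [set x | forall i, 0 <= slack i x].

Lemma weight_ge0 i x : chain_simplex x -> 0 <= weight i x.
Proof. by move=> /(_ i) x_ge0; rewrite divr_ge0. Qed.

Lemma step_in_simplex k : chain_simplex (step_point R k).
Proof. by move=> i; rewrite slack_step mulr_ge0. Qed.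

Lemma chain_simplex_convex : @convex_set R 'rV[R]_d chain_simplex.
Proof.
move=> y z t; rewrite !inE => y_ge0 z_ge0 i.
suff : 0 <= slack i (t%:num *: (y : 'rV[R]_d)
                     + (1 - t%:num) *: (z : 'rV[R]_d)) by [].
by rewrite slack_conv addr_ge0// mulr_ge0// ?y_ge0 ?z_ge0// subr_ge0.
Qed.

(** An affine functional takes at [x] the barycentric average of its values at the vertices. *)
Lemma affine_functional_slack (a : 'rV[R]_d) (b : R) x :
  b - dot a x =
  d.+1%:R^-1 * \sum_i slack i x * (b - dot a (step_point R i)).
Proof.
rewrite -[in LHS](sum_weight_step x) dot_sum.
rewrite [X in X - _](_ : b = \sum_i weight i x * b); last first.
  by rewrite -mulr_suml sum_weight mul1r.
rewrite -sumrB mulr_sumr; apply: eq_bigr => i _.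
by rewrite dotZ -mulrBr /weight mulrAC mulrC.
Qed.

(** * Affine independence and dimensions of faces *)

(** Apply the slack indexed by [f l] to the dependence: its constant term cancels since the
    coefficients sum to 0, and only n times the coefficient [c l] survives. *)
Lemma step_affinely_independent {m : nat} {f : 'I_m -> 'I_d.+1} :
  injective f -> affinely_independent (fun j => step_point R (f j)).
Proof.
move=> f_inj c sum_c sum_cp l.
have : \sum_j c j * slack (f l) (step_point R (f j)) = 0.
  under eq_bigr do rewrite mulrBr -dotZ.
  by rewrite sumrB -mulr_suml sum_c mul0r -dot_sum sum_cp dot0 subr0.
rewrite (bigD1 l)//= big1 => [|j jl]; last first.
  by rewrite slack_step (inj_eq f_inj) eq_sym (negbTE jl) !mulr0.
rewrite slack_step eqxx mulr1 addr0 => /eqP.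
by rewrite mulf_eq0 pnatr_eq0 orbF => /eqP.
Qed.

(* The rows of barycentric coordinates of affinely independent points are
   linearly independent, and only the columns in [F] are nonzero. *)
Lemma affinely_independent_card {F : {set 'I_d.+1}} {m : nat}
    {p : 'I_m -> 'rV[R]_d} :
  (forall j k, k \notin F -> slack k (p j) = 0) -> affinely_independent p ->
  (m <= #|F|)%N.
Proof.
move=> slackF aff_p.
pose M := \matrix_(j < m, l < #|F|) slack (enum_val l) (p j).
suff /eqP <- : row_free M by apply: rank_leq_col.
apply: inj_row_free => v vM; apply/rowP => j; rewrite mxE.
have sum_slackF k : \sum_j v 0 j * slack k (p j) = 0.
  have [kF|kF] := boolP (k \in F); last first.
    by apply: big1 => l _; rewrite slackF ?mulr0.
  have /rowP/(_ (enum_rank_in kF k)) := vM.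
  rewrite !mxE => vM0; rewrite -[RHS]vM0; apply: eq_bigr => l _.
  by rewrite mxE enum_rankK_in.
apply: (aff_p (fun l => v 0 l)).
  (* The slacks of each point sum to n, so n times the sum of the [v 0 l] is a sum of vanishing
     column sums. *)
  apply: (mulIf (_ : d.+1%:R != 0 :> R)); first by rewrite pnatr_eq0.
  rewrite mul0r mulr_suml.
  under eq_bigr => l _ do rewrite -(sum_slack (p l)) mulr_sumr.
  by rewrite exchange_big big1.
under eq_bigr => l _ do rewrite -[p l]sum_weight_step scaler_sumr.
rewrite exchange_big big1// => k _ /=.
under eq_bigr do rewrite scalerA /weight mulrA.
by rewrite -scaler_suml -mulr_suml sum_slackF mul0r scale0r.
Qed.

Lemma affine_rank_uniq {S : set 'rV[R]_d} {r s : nat} :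
  affine_rank S r -> affine_rank S s -> r = s.
Proof.
move=> [[p Sp aff_p] max_r] [[q Sq aff_q] max_s]; apply/eqP.
by rewrite eqn_leq (max_s _ p)// (max_r _ q).
Qed.

Lemma affine_rank_simplex : affine_rank chain_simplex d.+1.
Proof.
split=> [|m p _ aff_p].
  exists (step_point R); first exact: step_in_simplex.
  exact: (step_affinely_independent (f:=id)).
rewrite -[d.+1]card_ord -cardsT; apply: affinely_independent_card aff_p => j k.
by rewrite inE.
Qed.

(** This face contains the d vertices other than a^(i), and barycentric coordinate i vanishes on
    it. *)
Lemma affine_rank_chain_facet i :
  affine_rank (chain_simplex `&` [set x | slack i x = 0]) d.
Proof.
split=> [|m p face_p aff_p].
  exists (fun j => step_point R (lift i j)) => [j|].
    split; first exact: step_in_simplex.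
    by rewrite /= slack_step (negbTE (neq_lift i j)) mulr0.
  exact: step_affinely_independent lift_inj.
have -> : d = #|[set~ i]%SET| by rewrite cardsC1 card_ord.
apply: affinely_independent_card aff_p => j k; rewrite !inE negbK => /eqP ->.
by have [] := face_p j.
Qed.

(** * Facet-defining inequalities *)

Lemma chain_facet_defining i (c : R) : 0 < c ->
  facet_defining chain_simplex (c *: chain_coef R i) (c * chain_rhs R i).
Proof.
move=> c_gt0.
have dot_c x : dot (c *: chain_coef R i) x = c * dot (chain_coef R i) x.
  by rewrite /dot mulr_sumr; apply: eq_bigr => j _; rewrite mxE mulrA.
split=> [x x_ge0|]; first by rewrite dot_c ler_pM2l// -subr_ge0 x_ge0.
exists d; first exact: affine_rank_simplex.
rewrite [X in affine_rank (_ `&` X)](_ : _ = [set x | slack i x = 0]).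
  exact: affine_rank_chain_facet.
apply/seteqP; split=> x /=; rewrite dot_c.
  by move/(mulfI (lt0r_neq0 c_gt0)) => eq_x; rewrite /slack eq_x subrr.
by move/subr0_eq => ->.
Qed.

Lemma facet_defining_chain (a : 'rV[R]_d) (b : R) :
  facet_defining chain_simplex a b ->
  exists i (c : R), [/\ 0 < c, a = c *: chain_coef R i & b = c * chain_rhs R i].
Proof.
case=> [valid [r /affine_rank_uniq/(_ affine_rank_simplex)[->]]].
set face := _ `&` _ => rank_face.
pose g k := b - dot a (step_point R k).
have g_ge0 k : 0 <= g k by rewrite subr_ge0; apply/valid/step_in_simplex.
have gE x : b - dot a x = d.+1%:R^-1 * \sum_k slack k x * g k.
  exact: affine_functional_slack.
(* The face is spanned by the vertices in [F], so the dimension count leaves a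
   single vertex outside [F]. *)
pose F := [set k | g k == 0]%SET.
have slackF x k : face x -> k \notin F -> slack k x = 0.
  move=> [x_ge0 /= tight]; rewrite inE => gk_neq0.
  have /eqP := gE x; rewrite tight subrr eq_sym mulf_eq0 invr_eq0 pnatr_eq0 /=.
  move=> /eqP/psumr_eq0P/(_ k isT)/eqP.
  rewrite mulf_eq0 (negbTE gk_neq0) orbF => tight_k; apply/eqP/tight_k => l _.
  by rewrite mulr_ge0.
have cardF : #|F| = d.
  apply/eqP; rewrite eqn_leq; apply/andP; split; last first.
    have [[p face_p aff_p] _] := rank_face.
    by apply: affinely_independent_card aff_p => j k; apply: slackF.
  (* If the inequality were tight at every vertex, the face would be the whole simplex, of rank d +
     1 instead of d. *)
  rewrite -ltnS -[X in (_ < X)%N]card_ord -cardsT; apply: proper_card.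
  rewrite finset.properEneq finset.subsetT andbT; apply/eqP => FT.
  have g0 k : g k = 0 by apply/eqP; have := finset.in_setT k; rewrite -FT inE.
  suff face_full : face = chain_simplex.
    rewrite face_full in rank_face.
    by have /esym/n_Sn := affine_rank_uniq affine_rank_simplex rank_face.
  apply/seteqP; split=> x; first by case.
  move=> x_ge0; split=> //=; apply/esym/subr0_eq.
  by rewrite gE big1 ?mulr0// => k _; rewrite g0 mulr0.
have /eqP/cards1P[i FiE] : #|~: F| = 1%N.
  by have := cardsC F; rewrite cardF card_ord; lia.
have notinF k : (g k != 0) = (k == i).
  by have := finset.in_set1 k i; rewrite -FiE !inE.
pose c := g i / d.+1%:R.
have c_gt0 : 0 < c by rewrite divr_gt0 ?ltr0n// lt_neqAle g_ge0 eq_sym notinF eqxx.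
(* This identity holds on the whole space, so evaluating it at 0 and at the unit vectors determines
   [b] and [a]. *)
have affE x : b - dot a x = c * slack i x.
  rewrite gE (bigD1 i)//= big1 => [|k ki]; last first.
    by move: ki; rewrite -notinF negbK => /eqP ->; rewrite mulr0.
  by rewrite addr0 /c [slack i x * _]mulrC mulrA [_^-1 * _]mulrC.
have bE : b = c * chain_rhs R i.
  by have := affE 0; rewrite /slack !dot0 !subr0.
exists i, c; split=> //; apply/rowP => j; rewrite mxE; have := affE (delta_mx 0 j).
by rewrite /slack mulrBr -bE !dot_delta => /addrI/oppr_inj.
Qed.

(** * Extreme points *)

Lemma extreme_points_simplex :
  extreme_points chain_simplex = [set step_point R k | k in [set: 'I_d.+1]].
Proof.
apply/seteqP; split=> [x [x_ge0 x_extreme]|_ [k _ <-]]; last first.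
  split=> [|y z t y_ge0 z_ge0 t_gt0 t_lt1 stepE]; first exact: step_in_simplex.
  (* A slack that is 0 at a^(k) is a combination, with positive coefficients, of its nonnegative
     values at [y] and [z]. *)
  have off_k i : i != k -> slack i y = 0 /\ slack i z = 0.
    move=> ik; have t'_gt0 : 0 < 1 - t by rewrite subr_gt0.
    have := slack_conv i t y z; rewrite -stepE slack_step (negbTE ik) mulr0.
    move/esym/eqP; rewrite paddr_eq0 ?mulr_ge0 ?(ltW t_gt0) ?(ltW t'_gt0)//.
    by rewrite !mulf_eq0 (gt_eqF t_gt0) (gt_eqF t'_gt0) => /andP[/eqP -> /eqP ->].
  suff vertexE w : (forall i, i != k -> slack i w = 0) -> w = step_point R k.
    by split; apply: vertexE => i /off_k[].
  move=> w0; rewrite -(sum_weight_step w) (bigD1 k)//= big1 => [|i ik].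
    have := sum_weight w; rewrite (bigD1 k)//= big1 => [|i ik].
      by rewrite !addr0 => ->; rewrite scale1r.
    by rewrite /weight w0 ?mul0r.
  by rewrite /weight w0 ?mul0r ?scale0r.
have [k wk_gt0] : exists k, 0 < weight k x.
  apply/existsP; apply: contraT; rewrite negb_exists => /forallP w_le0.
  have := sum_weight x; rewrite big1 => [/eqP|k _].
    by rewrite eq_sym oner_eq0.
  by apply: le_anti; rewrite weight_ge0// leNgt w_le0.
exists k => //.
have wk_le1 : weight k x <= 1.
  rewrite -(sum_weight x) (bigD1 k)//= lerDl sumr_ge0// => i _.
  exact: weight_ge0.
have [wk1|wk_neq1] := eqVneq (weight k x) 1.
  rewrite -[RHS]sum_weight_step (bigD1 k)//= wk1 scale1r big1 ?addr0// => i ik.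
  have := sum_weight x; rewrite (bigD1 k)//= wk1 => /eqP.
  rewrite -subr_eq0 addrAC subrr add0r => /eqP/psumr_eq0P -> //.
    by rewrite scale0r.
  by move=> j _; apply: weight_ge0.
set t := weight k x in wk_gt0 wk_le1 wk_neq1.
have t_lt1 : t < 1 by rewrite lt_neqAle wk_neq1.
have t'_gt0 : 0 < 1 - t by rewrite subr_gt0.
(* [z] is where the ray from a^(k) through [x] meets the opposite face. Extremality of [x] on this
   segment forces x = a^(k). *)
pose z := (1 - t)^-1 *: (x - t *: step_point R k).
have xE : x = t *: step_point R k + (1 - t) *: z.
  by rewrite scalerA divff ?gt_eqF// scale1r subrKC.
have z_ge0 : chain_simplex z.
  move=> i; rewrite -(pmulr_rge0 _ t'_gt0).
  have -> : (1 - t) * slack i z = slack i x - t * slack i (step_point R k).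
    by rewrite [in RHS]xE slack_conv addrAC subrr add0r.
  rewrite slack_step; have [->|_] := eqVneq i k; last by rewrite !mulr0 subr0.
  by rewrite mulr1 divfK ?pnatr_eq0// subrr.
by have [] := x_extreme _ _ t (step_in_simplex k) z_ge0 wk_gt0 t_lt1 xE.
Qed.

(** * The polytope of dual degree partitions *)

(** The padding agrees with the dual degrees at both ends: all n vertices have degree at least 0,
    and without loops none has degree n. The counts decrease as the threshold grows. *)
Lemma dual_degree_point_in_simplex {e : rel 'I_d.+1} : simple_graph e ->
  chain_simplex (dual_degree_point R e).
Proof.
move=> [_ e_irr].
have paddedE (m : nat) : (m <= d.+1)%N ->
    padded (dual_degree_point R e) m = (dual_degree e m)%:R.
  rewrite leq_eqVlt => /predU1P[->|]; last first.
    case: m => [_|m lt_md]; first by rewrite /padded /= /dual_degree cardsE card_ord.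
    by rewrite (padded_ord _ (Ordinal (lt_md : (m < d)%N))) mxE.
  rewrite padded_last; apply/esym/eqP; rewrite pnatr_eq0 cards_eq0.
  apply/eqP/setP => k; rewrite !inE leqNgt ltnS.
  have : (degree e k <= #|[set~ k]%SET|)%N.
    apply/subset_leq_card/fintype.subsetP => l; rewrite !inE.
    by apply: contraTneq => ->; rewrite e_irr.
  by rewrite cardsC1 card_ord => ->.
move=> i; rewrite slackE !paddedE ?(ltn_ord i) ?(ltnW (ltn_ord i))//.
rewrite subr_ge0 ler_nat; apply/subset_leq_card/fintype.subsetP => k.
by rewrite !inE; apply: ltnW.
Qed.

Lemma step_dual_degree_point k : odd d ->
  exists2 e : rel 'I_d.+1,
    simple_graph e & dual_degree_point R e = step_point R k.
Proof.
move=> d_odd; have [e eS deg_e] := exists_regular_graph d_odd (leq_ord k).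
exists e => //; apply/rowP => j; rewrite !mxE /dual_degree.
under eq_finset do rewrite deg_e.
by case: (ltnP j k) => _; rewrite ?cardsT ?card_ord ?cards0.
Qed.

(** Any convex set containing the dual degree partitions contains the points a^(k), hence all their
    convex combinations, which fill the simplex. *)
Lemma dual_degree_polytopeE : odd d ->
  dual_degree_polytope R d.+1 = chain_simplex.
Proof.
move=> d_odd; apply/seteqP; split=> [|x x_ge0 A [cvxA ddA]].
  apply: smallest_sub; first exact: chain_simplex_convex.
  by move=> _ [e eS <-]; apply: dual_degree_point_in_simplex.
rewrite -(sum_weight_step x); apply: (convex_set_sum cvxA) => [i||i].
- exact: weight_ge0.
- exact: sum_weight.
- by apply: ddA; have [e eS <-] := step_dual_degree_point i d_odd; exists e.
Qed.

End Slack.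

Theorem theorem2p1 (R : realType) (n : nat) (n_gt0 : (0 < n)%N)
    (n_even : ~~ odd n) :
  [/\ dual_degree_polytope R n =
        [set x : 'rV[R]_n.-1 |
           sorted >=%R (n%:R :: rcons [seq x 0 j | j : 'I_n.-1] 0)],
      forall (a : 'rV[R]_n.-1) (b : R),
        facet_defining (dual_degree_polytope R n) a b <->
        exists (i : 'I_n) (c : R),
          [/\ 0 < c, a = c *: chain_coef R i & b = c * chain_rhs R i]
    & extreme_points (dual_degree_polytope R n) =
        [set step_point R k | k in [set: 'I_n]] ].
Proof.
case: n n_gt0 n_even => [//|d] _ /=; rewrite negbK => d_odd.
rewrite dual_degree_polytopeE//; split=> [|a b|].
- by apply/seteqP; split=> x /=; rewrite chain_sortedP.
- split; first exact: facet_defining_chain.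
  by move=> [i [c [c_gt0 -> ->]]]; apply: chain_facet_defining.
- exact: extreme_points_simplex.
Qed.
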